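(* Let $\alpha,\delta\in\mathbb{R}$ and let the pressure function $p:(0,\infty)\to\mathbb{R}$ have derivative $p'(\rho)=\alpha\rho^{\delta}$. With $\gamma=\delta+1$ this means $p(\rho)=\frac{\alpha}{\gamma}\rho^{\gamma}+\mathrm{const}$ if $\gamma\neq 0$, and $p(\rho)=\alpha\log(\rho)+\mathrm{const}$ if $\gamma=0$. Then the following hold. (1) The pressure function is admissible (i.e. $p'>0$ on $(0,\infty)$) and for any sub-sonic states $U_l=(\rho_l,q_l)$, $U_r=(\rho_r,q_r)$ the Lax curves $L_l(\cdot;\rho_l,q_l)$ and $L_r(\cdot;\rho_r,q_r)$ have a unique intersection point at some $\rho>0$ (i.e. there is exactly one $\rho>0$ with $L_l(\rho;\rho_l,q_l)=L_r(\rho;\rho_r,q_r)$), if and only if $|\delta|\le 2$ and $\alpha>0$. (2) For every $\delta$ with $|\delta|>2$ (and every $\alpha>0$) there are sub-sonic states $U_l=(\rho_l,q_l)$, $U_r=(\rho_r,q_r)$ such that the Lax curves $L_l(\cdot;\rho_l,q_l)$ and $L_r(\cdot;\rho_r,q_r)$ have no intersection at all on $(0,\infty)$.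
   Context: Setting: the isentropic Euler equations $\rho_t+q_x=0$, $q_t+(p(\rho)+q^2/\rho)_x=0$ with density $\rho>0$, momentum $q\in\mathbb{R}$ and pressure law $p$. Standing assumption (strict hyperbolicity): $p'>0$ on $(0,\infty)$. Put $c(\rho)=\sqrt{p'(\rho)}$. A state $(\rho,q)$ with $\rho>0$ is sub-sonic if $|q/\rho|<c(\rho)$. For $\rho,\bar\rho>0$ let $f(\rho,\bar\rho)=\frac{\rho}{\bar\rho}(\rho-\bar\rho)\,(p(\rho)-p(\bar\rho))$. The Lax curves through $(\rho_l,q_l)$ and $(\rho_r,q_r)$ are the functions of $\rho>0$ $$L_l(\rho;\rho_l,q_l)=\begin{cases}\rho\left(\frac{q_l}{\rho_l}+\int_{\rho}^{\rho_l}\frac{c(s)}{s}\,ds\right)&\rho\le\rho_l,\\ \rho\frac{q_l}{\rho_l}-\sqrt{f(\rho,\rho_l)}&\rho\ge\rho_l,\end{cases}\qquad L_r(\rho;\rho_r,q_r)=\begin{cases}\rho\left(\frac{q_r}{\rho_r}-\int_{\rho}^{\rho_r}\frac{c(s)}{s}\,ds\right)&\rho\le\rho_r,\\ \rho\frac{q_r}{\rho_r}+\sqrt{f(\rho,\rho_r)}&\rho\ge\rho_r.\end{cases}$$ *)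

(* Defs.v *)
From Stdlib Require Import Reals.
From Coquelicot Require Import Coquelicot.
Open Scope R_scope.

(** Pressure laws are total functions [p : R -> R]; only their values on
    (0, +oo) are ever used. *)

Definition admissible (p : R -> R) : Prop :=
  forall rho : R, 0 < rho -> ex_derive p rho /\ 0 < Derive p rho.

Definition sound_speed (p : R -> R) (rho : R) : R := sqrt (Derive p rho).

(** The state with density [rho] and momentum [q]. *)
Definition subsonic (p : R -> R) (rho q : R) : Prop :=
  0 < rho /\ Rabs (q / rho) < sound_speed p rho.

Definition shock_fun (p : R -> R) (rho rhobar : R) : R :=
  rho / rhobar * (rho - rhobar) * (p rho - p rhobar).

(** In both curves the two branches agree at [rho = rhol] (resp. [rhor]). *)
Definition Lax_l (p : R -> R) (rhol ql rho : R) : R :=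
  if Rle_dec rho rhol
  then rho * (ql / rhol + RInt (fun s => sound_speed p s / s) rho rhol)
  else rho * (ql / rhol) - sqrt (shock_fun p rho rhol).

Definition Lax_r (p : R -> R) (rhor qr rho : R) : R :=
  if Rle_dec rho rhor
  then rho * (qr / rhor - RInt (fun s => sound_speed p s / s) rho rhor)
  else rho * (qr / rhor) + sqrt (shock_fun p rho rhor).

Definition Lax_intersect (p : R -> R) (rhol ql rhor qr rho : R) : Prop :=
  0 < rho /\ Lax_l p rhol ql rho = Lax_r p rhor qr rho.

(* Main.v *)
Require Import Defs.
From Stdlib Require Import Reals Ranalysis5 Lra Psatz.
From Coquelicot Require Import Coquelicot.
Open Scope R_scope.

(** Divide the curves by [rho].  With [u = q / rho] the velocities of the two
    states, both Lax curves are governed by one function of the density, the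
    velocity jump [jump b] across a wave connecting the densities [b] and
    [rho]: the curves are [rho * (ul - jump rhol rho)] and
    [rho * (ur + jump rhor rho)], so that they meet at [rho] exactly when
      [jump rhol rho + jump rhor rho = ul - ur].
    The left side is continuous and strictly increasing in [rho].  Hence there
    is at most one intersection, and there is one exactly when [ul - ur] lies
    strictly between the limits of the left side at 0 and at infinity.

    For [p' = alpha * rho ^ delta] these limits are explicit multiples of the
    sound speed [c b] (or infinite).  At 0 only the rarefaction branch matters
    and [jump b] tends to [- (2 / delta) * c b] if [delta > 0], to minus
    infinity otherwise.  At infinity only the shock branch matters and the
    limit is [c b / sqrt (- (delta + 1))] if [delta < -1], infinity otherwise.
    Sub-sonicity says [- (cl + cr) < ul - ur < cl + cr], without any better
    bound.  So all sub-sonic data are admitted exactly when both factors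
    [2 / delta] and [1 / sqrt (- (delta + 1))] are at least 1 whenever they
    occur, that is, when [delta <= 2] and [-2 <= delta].  Beyond these values
    two states of density 1 with opposite velocities, of modulus equal to the
    limit of [jump 1], are sub-sonic and their curves do not meet.

    The bounds are [jump_small] and [jump_large] for existence, and
    [jump_1_gt] and [jump_1_lt] for the counterexamples. *)

(** * Primitives of powers *)

(** The primitive of [x ^ (a - 1)] without constant term.  It serves twice: for
    the pressure, with [a = delta + 1], and for the integral of [c(s) / s], with
    [a = delta / 2]. *)
Definition power_prim (a x : R) : R :=
  if Req_EM_T a 0 then ln x else Rpower x a / a.

Lemma power_prim_0 (x : R) : power_prim 0 x = ln x.
Proof. unfold power_prim. destruct (Req_EM_T 0 0); congruence. Qed.

Lemma power_prim_neq0 (a x : R) : a <> 0 -> power_prim a x = Rpower x a / a.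
Proof. intros Ha. unfold power_prim. destruct (Req_EM_T a 0); congruence. Qed.

Lemma Rpower_pos (x a : R) : 0 < Rpower x a.
Proof. apply exp_pos. Qed.

Lemma Rpower_1_l (a : R) : Rpower 1 a = 1.
Proof. unfold Rpower. now rewrite ln_1, Rmult_0_r, exp_0. Qed.

Lemma is_derive_power_prim (a x : R) :
  0 < x -> is_derive (power_prim a) x (Rpower x (a - 1)).
Proof.
  intros Hx. destruct (Req_dec a 0) as [->|Ha].
  - apply is_derive_ext with ln; [intros; now rewrite power_prim_0|].
    rewrite Rminus_0_l, Rpower_Ropp, Rpower_1 by easy.
    now apply is_derive_ln.
  - apply is_derive_ext with (fun x => Rpower x a / a);
      [intros; now rewrite power_prim_neq0|].
    replace (Rpower x (a - 1)) with (Rpower x a / x).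
    + unfold Rpower. auto_derive; [easy|]. field. lra.
    + unfold Rminus. now rewrite Rpower_plus, Rpower_Ropp, Rpower_1.
Qed.

Lemma power_prim_incr (a x y : R) :
  0 < x -> x < y -> power_prim a x < power_prim a y.
Proof.
  intros Hx Hxy.
  apply (incr_function (power_prim a) (Finite 0) p_infty
           (fun x => Rpower x (a - 1))); simpl; auto.
  - intros z Hz _. now apply is_derive_power_prim.
  - intros. apply Rpower_pos.
Qed.

Lemma power_prim_le (a x y : R) :
  0 < x -> x <= y -> power_prim a x <= power_prim a y.
Proof.
  intros Hx [Hxy| ->]; [left; now apply power_prim_incr|apply Rle_refl].
Qed.

Lemma continuity_pt_power_prim (a x : R) :
  0 < x -> continuity_pt (power_prim a) x.
Proof.
  intros Hx. apply continuity_pt_filterlim, (ex_derive_continuous (power_prim a)).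
  eexists. now apply is_derive_power_prim.
Qed.

Lemma power_prim_surj (a m : R) :
  a = 0 \/ 0 < a * m -> exists x, 0 < x /\ power_prim a x = m.
Proof.
  intros [->|H].
  - exists (exp m). split; [apply exp_pos|]. now rewrite power_prim_0, ln_exp.
  - assert (Ha : a <> 0) by (intros ->; lra).
    exists (Rpower (a * m) (/ a)). split; [apply Rpower_pos|].
    rewrite power_prim_neq0, Rpower_mult, Rinv_l, Rpower_1 by easy.
    now field.
Qed.

(** The infimum of [power_prim a] over positive [x] is 0 if [a > 0] and minus
    infinity otherwise. *)
Lemma power_prim_small (a m : R) :
  (0 < a -> 0 < m) -> exists x, 0 < x /\ power_prim a x < m.
Proof.
  intros H. destruct (Rtotal_order a 0) as [Ha|[->|Ha]].
  - destruct (power_prim_surj a (Rmin m 0 - 1)) as (x & Hx & E).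
    + right. generalize (Rmin_r m 0). nra.
    + exists x. split; [easy|]. generalize (Rmin_l m 0). lra.
  - destruct (power_prim_surj 0 (m - 1)) as (x & Hx & E); [now left|].
    exists x. lra.
  - destruct (power_prim_surj a (m / 2)) as (x & Hx & E).
    + right. specialize (H Ha). nra.
    + exists x. specialize (H Ha). lra.
Qed.

(** The supremum of [power_prim a] over positive [x] is 0 if [a < 0] and
    infinity otherwise. *)
Lemma power_prim_large (a m : R) :
  (a < 0 -> m < 0) -> exists x, 0 < x /\ m < power_prim a x.
Proof.
  intros H. destruct (Rtotal_order a 0) as [Ha|[->|Ha]].
  - destruct (power_prim_surj a (m / 2)) as (x & Hx & E).
    + right. specialize (H Ha). nra.
    + exists x. specialize (H Ha). lra.
  - destruct (power_prim_surj 0 (m + 1)) as (x & Hx & E); [now left|].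
    exists x. lra.
  - destruct (power_prim_surj a (Rmax m 0 + 1)) as (x & Hx & E).
    + right. generalize (Rmax_r m 0). nra.
    + exists x. split; [easy|]. generalize (Rmax_l m 0). lra.
Qed.

(** * The velocity jump across a wave *)

(** The sound speed of the pressure law [p' = alpha * rho ^ delta]. *)
Definition power_speed (alpha delta b : R) : R :=
  sqrt alpha * Rpower b (delta / 2).

Definition rarefaction (alpha delta b x : R) : R :=
  sqrt alpha * (power_prim (delta / 2) x - power_prim (delta / 2) b).

(** The square root of [f (x, b)], divided by [x]. *)
Definition shock (alpha delta b x : R) : R :=
  sqrt ((/ b - / x) *
        (alpha * (power_prim (delta + 1) x - power_prim (delta + 1) b))).

(** Since both branches vanish at [x = b], clamping their arguments at [b] turns
    the definition by cases into a sum; continuity and monotonicity then need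
    no gluing. *)
Definition jump (alpha delta b x : R) : R :=
  rarefaction alpha delta b (Rmin x b) + shock alpha delta b (Rmax x b).

Lemma rarefaction_refl (alpha delta b : R) : rarefaction alpha delta b b = 0.
Proof. unfold rarefaction. ring. Qed.

Lemma shock_refl (alpha delta b : R) : shock alpha delta b b = 0.
Proof. unfold shock. rewrite Rminus_diag, Rmult_0_l. apply sqrt_0. Qed.

Lemma jump_left (alpha delta b x : R) :
  x <= b -> jump alpha delta b x = rarefaction alpha delta b x.
Proof.
  intros H. unfold jump. rewrite Rmin_left, Rmax_right, shock_refl by easy. ring.
Qed.

Lemma jump_right (alpha delta b x : R) :
  b <= x -> jump alpha delta b x = shock alpha delta b x.
Proof.
  intros H. unfold jump.
  rewrite Rmin_right, Rmax_left, rarefaction_refl by easy. ring.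
Qed.

Lemma rarefaction_incr (alpha delta b x y : R) :
  0 < alpha -> 0 < x -> x < y ->
  rarefaction alpha delta b x < rarefaction alpha delta b y.
Proof.
  intros Ha Hx Hxy. unfold rarefaction.
  apply Rmult_lt_compat_l; [now apply sqrt_lt_R0|].
  generalize (power_prim_incr (delta / 2) x y Hx Hxy). lra.
Qed.

Lemma shock_incr (alpha delta b x y : R) :
  0 < alpha -> 0 < b -> b <= x -> x < y ->
  shock alpha delta b x < shock alpha delta b y.
Proof.
  intros Ha Hb Hx Hxy. unfold shock.
  assert (Hi : / y < / x) by (apply Rinv_lt_contravar; nra).
  assert (Hi' : / x <= / b) by (apply Rinv_le_contravar; lra).
  assert (H1 := power_prim_le (delta + 1) b x Hb Hx).
  assert (H2 := power_prim_incr (delta + 1) x y ltac:(lra) Hxy).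
  apply sqrt_lt_1_alt. split.
  - apply Rmult_le_pos; [lra|]. apply Rmult_le_pos; lra.
  - apply Rmult_le_0_lt_compat; try lra.
    + apply Rmult_le_pos; lra.
    + apply Rmult_lt_compat_l; lra.
Qed.

Lemma jump_incr (alpha delta b x y : R) :
  0 < alpha -> 0 < b -> 0 < x -> x < y ->
  jump alpha delta b x < jump alpha delta b y.
Proof.
  intros Ha Hb Hx Hxy.
  assert (L : forall z, 0 < z -> z < y -> z <= b ->
              rarefaction alpha delta b z <= jump alpha delta b y).
  { intros z Hz Hzy Hzb. destruct (Rle_dec y b) as [H|H].
    - rewrite jump_left by easy. left. now apply rarefaction_incr.
    - rewrite jump_right by lra. apply Rle_trans with 0.
      + rewrite <- (rarefaction_refl alpha delta b).
        destruct Hzb as [Hzb| ->]; [left; now apply rarefaction_incr|lra].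
      + apply sqrt_pos. }
  destruct (Rlt_dec x b) as [H|H].
  - rewrite jump_left by lra.
    assert (Hm : x < Rmin y b) by (now apply Rmin_glb_lt).
    (* A strict gain is taken at the midpoint of [x] and [Rmin y b]. *)
    apply Rlt_le_trans with (rarefaction alpha delta b ((x + Rmin y b) / 2)).
    + apply rarefaction_incr; lra.
    + generalize (Rmin_l y b) (Rmin_r y b). intros. apply L; lra.
  - rewrite !jump_right by lra. apply shock_incr; lra.
Qed.

Lemma continuity_pt_Rmin_r (b x : R) : continuity_pt (fun x => Rmin x b) x.
Proof.
  apply continuity_pt_ext with (fun x => (x + b - Rabs (x - b)) / 2).
  { intros t. unfold Rmin, Rabs.
    destruct (Rle_dec t b), (Rcase_abs (t - b)); lra. }
  assert (Hb : continuity_pt (fun _ => b) x) by now apply continuity_pt_const.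
  assert (Hx := continuity_pt_id x).
  apply (continuity_pt_mult (fun x => x + b - Rabs (x - b)) (fun _ => / 2));
    [|now apply continuity_pt_const].
  apply (continuity_pt_minus (fun x => x + b) (fun x => Rabs (x - b))).
  - now apply (continuity_pt_plus (fun x => x) (fun _ => b)).
  - apply (continuity_pt_comp (fun x => x - b) Rabs).
    + now apply (continuity_pt_minus (fun x => x) (fun _ => b)).
    + apply Rcontinuity_abs.
Qed.

Lemma continuity_pt_Rmax_r (b x : R) : continuity_pt (fun x => Rmax x b) x.
Proof.
  apply continuity_pt_ext with (fun x => x + b - Rmin x b).
  { intros t. unfold Rmin, Rmax. destruct (Rle_dec t b); lra. }
  apply (continuity_pt_minus (fun x => x + b)).
  - apply (continuity_pt_plus (fun x => x)).
    + apply continuity_pt_id.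
    + now apply continuity_pt_const.
  - apply continuity_pt_Rmin_r.
Qed.

Lemma continuity_pt_rarefaction (alpha delta b x : R) :
  0 < x -> continuity_pt (rarefaction alpha delta b) x.
Proof.
  intros Hx. unfold rarefaction.
  apply (continuity_pt_scal (fun x => power_prim (delta / 2) x -
                                      power_prim (delta / 2) b)).
  apply continuity_pt_minus; [now apply continuity_pt_power_prim|].
  now apply continuity_pt_const.
Qed.

Lemma continuity_pt_shock (alpha delta b x : R) :
  0 < x -> continuity_pt (shock alpha delta b) x.
Proof.
  intros Hx. unfold shock.
  apply continuity_pt_filterlim.
  apply (continuous_comp (fun x => (/ b - / x) *
           (alpha * (power_prim (delta + 1) x - power_prim (delta + 1) b))) sqrt);
    [|apply continuous_sqrt].
  apply continuity_pt_filterlim.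
  apply (continuity_pt_mult (fun x => / b - / x)).
  - apply (continuity_pt_minus (fun _ => / b)).
    + now apply continuity_pt_const.
    + apply (continuity_pt_inv (fun x => x)); [apply continuity_pt_id|lra].
  - apply (continuity_pt_scal (fun x => power_prim (delta + 1) x -
                                        power_prim (delta + 1) b)).
    apply continuity_pt_minus; [now apply continuity_pt_power_prim|].
    now apply continuity_pt_const.
Qed.

Lemma continuity_pt_jump (alpha delta b x : R) :
  0 < b -> 0 < x -> continuity_pt (jump alpha delta b) x.
Proof.
  intros Hb Hx. unfold jump. apply continuity_pt_plus.
  - apply (continuity_pt_comp (fun x => Rmin x b) (rarefaction alpha delta b)).
    + apply continuity_pt_Rmin_r.
    + apply continuity_pt_rarefaction. now apply Rmin_glb_lt.
  - apply (continuity_pt_comp (fun x => Rmax x b) (shock alpha delta b)).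
    + apply continuity_pt_Rmax_r.
    + apply continuity_pt_shock. generalize (Rmax_l x b). lra.
Qed.

(** * Range of the velocity jump *)

Lemma power_speed_sqr (alpha delta b : R) :
  0 < alpha -> (power_speed alpha delta b)² = alpha * Rpower b delta.
Proof.
  intros Ha. unfold power_speed. rewrite Rsqr_mult, Rsqr_sqrt by lra.
  unfold Rsqr. rewrite <- Rpower_plus. do 2 f_equal. lra.
Qed.

(** The limit of [jump] at 0 is minus infinity or [- (2 / delta) * c b], and
    [2 / delta >= 1]. *)
Lemma jump_small (alpha delta b m : R) :
  0 < alpha -> delta <= 2 -> 0 < b -> Rabs m < power_speed alpha delta b ->
  exists x, 0 < x /\ jump alpha delta b x < m.
Proof.
  intros Ha Hd Hb Hm.
  assert (Hs := sqrt_lt_R0 alpha Ha).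
  destruct (power_prim_small (delta / 2)
              (power_prim (delta / 2) b + m / sqrt alpha)) as (x & Hx & H).
  - intros Hd'. rewrite power_prim_neq0 by lra.
    assert (H1 : - Rpower b (delta / 2) < m / sqrt alpha).
    { apply Rmult_lt_reg_r with (sqrt alpha); [easy|].
      unfold Rdiv at 2. rewrite Rmult_assoc, Rinv_l by lra.
      unfold power_speed in Hm. apply Rabs_def2 in Hm. lra. }
    assert (H2 : Rpower b (delta / 2) <= Rpower b (delta / 2) / (delta / 2)).
    { apply Rle_div_r; [lra|]. generalize (Rpower_pos b (delta / 2)). nra. }
    lra.
  - exists (Rmin x b).
    assert (Hmin : 0 < Rmin x b) by now apply Rmin_glb_lt.
    split; [easy|]. rewrite jump_left by apply Rmin_r.
    unfold rarefaction.
    generalize (power_prim_le (delta / 2) _ _ Hmin (Rmin_l x b)). intros H1.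
    replace m with (sqrt alpha * (m / sqrt alpha)) by (field; lra).
    apply Rmult_lt_compat_l; lra.
Qed.

(** The limit of [jump] at infinity is infinity or [c b / sqrt (- (delta + 1))],
    and [0 < - (delta + 1) <= 1] in the second case. *)
Lemma jump_large (alpha delta b m : R) :
  0 < alpha -> -2 <= delta -> 0 < b -> Rabs m < power_speed alpha delta b ->
  exists x, 0 < x /\ m < jump alpha delta b x.
Proof.
  intros Ha Hd Hb Hm.
  assert (Hsq : m² < alpha * Rpower b delta).
  { rewrite <- power_speed_sqr by easy. rewrite (Rsqr_abs m).
    apply Rsqr_incrst_1; [easy|apply Rabs_pos|].
    generalize (Rabs_pos m). lra. }
  assert (Hm0 := Rle_0_sqr m).
  (* The root exceeds [m] once its two factors do their share of the room
     between [m²] and the square of the sound speed: a pressure difference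
     above [b * k], and [1 - b / x] at least [m² / k]. *)
  set (k := (m² + alpha * Rpower b delta) / 2).
  assert (Hk1 : m² < k) by (unfold k; lra).
  assert (Hk2 : k < alpha * Rpower b delta) by (unfold k; lra).
  clearbody k.
  destruct (power_prim_large (delta + 1)
              (power_prim (delta + 1) b + b * k / alpha)) as (y & Hy & H).
  - intros Hd'. rewrite power_prim_neq0 by lra.
    assert (H1 : b * k / alpha < Rpower b (delta + 1)).
    { rewrite Rpower_plus, Rpower_1 by easy.
      apply Rlt_div_l; nra. }
    assert (H2 : Rpower b (delta + 1) / (delta + 1) <= - Rpower b (delta + 1)).
    { replace (Rpower b (delta + 1) / (delta + 1))
        with (- (Rpower b (delta + 1) / - (delta + 1))) by (field; lra).
      apply Ropp_le_contravar, Rle_div_r; [lra|].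
      generalize (Rpower_pos b (delta + 1)). nra. }
    lra.
  - (* The factor 2 keeps [z > b] when [m = 0]. *)
    set (z := 2 * b * k / (k - m²)).
    assert (Hz : b < z) by (unfold z; apply Rlt_div_r; nra).
    set (x := Rmax y z).
    assert (Hyx : y <= x) by apply Rmax_l.
    assert (Hzx : z <= x) by apply Rmax_r.
    exists x. split; [lra|]. rewrite jump_right by lra. unfold shock.
    apply Rle_lt_trans with (Rabs m); [apply Rle_abs|].
    rewrite <- sqrt_Rsqr_abs. apply sqrt_lt_1_alt. split; [easy|].
    assert (Hp : b * k < alpha * (power_prim (delta + 1) x - power_prim (delta + 1) b)).
    { generalize (power_prim_le (delta + 1) y x Hy Hyx). intros Hyx'.
      replace (b * k) with (alpha * (b * k / alpha)) by (field; lra).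
      apply Rmult_lt_compat_l; lra. }
    assert (Hi : m² <= (/ b - / x) * (b * k)).
    { apply Rle_trans with ((/ b - / z) * (b * k)).
      - replace ((/ b - / z) * (b * k)) with ((k + m²) / 2); [lra|].
        unfold z. field. repeat split; lra.
      - apply Rmult_le_compat_r; [nra|].
        assert (/ x <= / z) by (apply Rinv_le_contravar; lra). lra. }
    assert (Hi0 : 0 < / b - / x).
    { assert (/ x < / b) by (apply Rinv_lt_contravar; nra). lra. }
    apply Rle_lt_trans with (1 := Hi). now apply Rmult_lt_compat_l.
Qed.

(** The two bounds at density 1, where the sound speed is [sqrt alpha]: the
    limits of [jump] at 0 and at infinity are not attained. *)
Lemma jump_1_gt (alpha delta x : R) :
  0 < alpha -> 0 < delta -> 0 < x ->
  - (sqrt alpha * (2 / delta)) < jump alpha delta 1 x.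
Proof.
  intros Ha Hd Hx. unfold jump.
  assert (Hs := sqrt_lt_R0 alpha Ha).
  assert (H0 : 0 <= shock alpha delta 1 (Rmax x 1)) by apply sqrt_pos.
  enough (- (sqrt alpha * (2 / delta)) < rarefaction alpha delta 1 (Rmin x 1))
    by lra.
  unfold rarefaction. rewrite !power_prim_neq0, Rpower_1_l by lra.
  assert (0 < Rpower (Rmin x 1) (delta / 2) / (delta / 2)).
  { apply Rdiv_lt_0_compat; [apply Rpower_pos|lra]. }
  replace (1 / (delta / 2)) with (2 / delta) by (field; lra).
  nra.
Qed.

Lemma jump_1_lt (alpha delta x : R) :
  0 < alpha -> delta < -1 -> 0 < x ->
  jump alpha delta 1 x < sqrt (alpha / - (delta + 1)).
Proof.
  intros Ha Hd Hx.
  assert (Hpos : 0 < alpha / - (delta + 1)) by (apply Rdiv_lt_0_compat; lra).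
  (* By monotonicity only the shock branch has to be considered. *)
  apply Rlt_le_trans with (jump alpha delta 1 (x + 1)).
  { apply jump_incr; lra. }
  rewrite jump_right by lra. unfold shock.
  apply sqrt_le_1_alt.
  rewrite !power_prim_neq0, Rpower_1_l by lra.
  assert (Hi : 0 < / (x + 1)) by (apply Rinv_0_lt_compat; lra).
  assert (Hi' : / (x + 1) < 1).
  { rewrite <- Rinv_1. apply Rinv_lt_contravar; lra. }
  assert (HP : 0 < Rpower (x + 1) (delta + 1) / - (delta + 1)).
  { apply Rdiv_lt_0_compat; [apply Rpower_pos|lra]. }
  replace (alpha * (Rpower (x + 1) (delta + 1) / (delta + 1) - 1 / (delta + 1)))
    with (alpha / - (delta + 1) -
          alpha * (Rpower (x + 1) (delta + 1) / - (delta + 1))) by (field; lra).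
  rewrite Rinv_1.
  generalize dependent (Rpower (x + 1) (delta + 1) / - (delta + 1)).
  generalize dependent (alpha / - (delta + 1)).
  intros u Hu P HP. assert (0 < alpha * P) by now apply Rmult_lt_0_compat.
  nra.
Qed.

(** * The Lax curves of a power law *)

Section PowerLaw.

Variables (alpha delta : R) (p : R -> R).
Hypothesis Hp : forall rho : R,
  0 < rho -> is_derive p rho (alpha * Rpower rho delta).

Lemma pressure_power_prim :
  exists k, forall rho, 0 < rho -> p rho = alpha * power_prim (delta + 1) rho + k.
Proof.
  set (g := fun rho => p rho - alpha * power_prim (delta + 1) rho).
  assert (Hg : forall t, 0 < t -> is_derive g t zero).
  { intros t Ht. unfold g.
    replace (@zero R_NormedModule)
      with (minus (alpha * Rpower t delta) (alpha * Rpower t (delta + 1 - 1))).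
    - apply (is_derive_minus p (fun rho => alpha * power_prim (delta + 1) rho));
        [now apply Hp|].
      now apply (is_derive_scal (power_prim (delta + 1))), is_derive_power_prim.
    - replace (delta + 1 - 1) with delta by ring.
      apply (minus_eq_zero (G := R_AbelianGroup)). }
  exists (g 1). intros rho Hrho.
  enough (g rho = g 1) by (unfold g in *; lra).
  destruct (Rtotal_order rho 1) as [H|[->|H]]; [|easy|].
  - apply (eq_is_derive g rho 1); [intros t Ht; apply Hg; lra|easy].
  - symmetry. apply (eq_is_derive g 1 rho); [intros t Ht; apply Hg; lra|easy].
Qed.

Lemma sound_speed_power (rho : R) :
  0 < alpha -> 0 < rho -> sound_speed p rho = power_speed alpha delta rho.
Proof.
  intros Ha Hr. unfold sound_speed.
  rewrite (is_derive_unique _ _ _ (Hp rho Hr)), <- power_speed_sqr by easy.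
  apply sqrt_Rsqr. unfold power_speed.
  apply Rmult_le_pos; [apply sqrt_pos|left; apply Rpower_pos].
Qed.

Lemma RInt_sound_speed (rho b : R) :
  0 < alpha -> 0 < rho -> rho <= b ->
  RInt (fun s => sound_speed p s / s) rho b = - rarefaction alpha delta b rho.
Proof.
  intros Ha Hr Hb.
  assert (Hpos : forall s, Rmin rho b <= s -> 0 < s).
  { intros s. rewrite Rmin_left by easy. lra. }
  assert (Heq : forall s, 0 < s ->
            sqrt alpha * Rpower s (delta / 2 - 1) = sound_speed p s / s).
  { intros s Hs. rewrite sound_speed_power by easy. unfold power_speed, Rminus.
    rewrite Rpower_plus, Rpower_Ropp, Rpower_1 by easy. field. lra. }
  apply is_RInt_unique.
  apply (is_RInt_ext (fun s => sqrt alpha * Rpower s (delta / 2 - 1))).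
  { intros s [Hs _]. apply Heq, Hpos. lra. }
  replace (- rarefaction alpha delta b rho)
    with (minus (sqrt alpha * power_prim (delta / 2) b)
                (sqrt alpha * power_prim (delta / 2) rho))
    by (unfold rarefaction, minus, plus, opp; simpl; ring).
  apply (is_RInt_derive (fun s => sqrt alpha * power_prim (delta / 2) s)).
  - intros s [Hs _].
    apply (is_derive_scal (power_prim (delta / 2))), is_derive_power_prim.
    now apply Hpos.
  - intros s [Hs _]. apply Hpos in Hs.
    apply (ex_derive_continuous (fun s => sqrt alpha * Rpower s (delta / 2 - 1))).
    unfold Rpower. now auto_derive.
Qed.

Lemma sqrt_shock_fun (rho b : R) :
  0 < b -> 0 < rho ->
  sqrt (shock_fun p rho b) = rho * shock alpha delta b rho.
Proof.
  intros Hb Hr. destruct pressure_power_prim as [k Hk].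
  unfold shock, shock_fun. rewrite (Hk rho), (Hk b) by easy.
  rewrite <- (sqrt_Rsqr rho) at 4 by lra.
  rewrite <- sqrt_mult_alt by apply Rle_0_sqr.
  f_equal. unfold Rsqr. field. lra.
Qed.

Lemma Lax_l_jump (b q rho : R) :
  0 < alpha -> 0 < b -> 0 < rho ->
  Lax_l p b q rho = rho * (q / b - jump alpha delta b rho).
Proof.
  intros Ha Hb Hr. unfold Lax_l. destruct (Rle_dec rho b) as [H|H].
  - rewrite RInt_sound_speed, jump_left by easy. ring.
  - rewrite sqrt_shock_fun, jump_right by lra. ring.
Qed.

Lemma Lax_r_jump (b q rho : R) :
  0 < alpha -> 0 < b -> 0 < rho ->
  Lax_r p b q rho = rho * (q / b + jump alpha delta b rho).
Proof.
  intros Ha Hb Hr. unfold Lax_r. destruct (Rle_dec rho b) as [H|H].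
  - rewrite RInt_sound_speed, jump_left by easy. ring.
  - rewrite sqrt_shock_fun, jump_right by lra. ring.
Qed.

Lemma Lax_intersect_jump (rhol ql rhor qr rho : R) :
  0 < alpha -> 0 < rhol -> 0 < rhor ->
  Lax_intersect p rhol ql rhor qr rho <->
  0 < rho /\
  jump alpha delta rhol rho + jump alpha delta rhor rho = ql / rhol - qr / rhor.
Proof.
  intros Ha Hl Hr. unfold Lax_intersect.
  split; intros [Hrho H]; (split; [easy|]).
  - rewrite Lax_l_jump, Lax_r_jump in H by easy.
    apply Rmult_eq_reg_l in H; lra.
  - rewrite Lax_l_jump, Lax_r_jump by easy. f_equal. lra.
Qed.

Lemma Lax_intersect_unique (rhol ql rhor qr x y : R) :
  0 < alpha -> 0 < rhol -> 0 < rhor ->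
  Lax_intersect p rhol ql rhor qr x -> Lax_intersect p rhol ql rhor qr y ->
  x = y.
Proof.
  intros Ha Hl Hr Hx Hy.
  apply Lax_intersect_jump in Hx, Hy; try easy.
  destruct Hx as [Hx Ex], Hy as [Hy Ey].
  destruct (Rtotal_order x y) as [H|[H|H]]; [|easy|].
  - generalize (jump_incr alpha delta rhol x y Ha Hl Hx H)
               (jump_incr alpha delta rhor x y Ha Hr Hx H). lra.
  - generalize (jump_incr alpha delta rhol y x Ha Hl Hy H)
               (jump_incr alpha delta rhor y x Ha Hr Hy H). lra.
Qed.

(** The intermediate value theorem between a density where both jumps lie below
    [ul] and [- ur], and one where both lie above. *)
Lemma Lax_intersect_exists (rhol ql rhor qr : R) :
  0 < alpha -> Rabs delta <= 2 -> subsonic p rhol ql -> subsonic p rhor qr ->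
  exists rho, Lax_intersect p rhol ql rhor qr rho.
Proof.
  intros Ha Hd [Hl Hul] [Hr Hur].
  rewrite sound_speed_power in Hul, Hur by easy.
  rewrite <- Rabs_Ropp in Hur.
  apply Rabs_le_between in Hd. destruct Hd as [Hd1 Hd2].
  destruct (jump_small _ _ _ _ Ha Hd2 Hl Hul) as (x1 & Hx1 & E1).
  destruct (jump_small _ _ _ _ Ha Hd2 Hr Hur) as (x2 & Hx2 & E2).
  destruct (jump_large _ _ _ _ Ha Hd1 Hl Hul) as (y1 & Hy1 & F1).
  destruct (jump_large _ _ _ _ Ha Hd1 Hr Hur) as (y2 & Hy2 & F2).
  assert (mono : forall b x y, 0 < b -> 0 < x -> x <= y ->
            jump alpha delta b x <= jump alpha delta b y).
  { intros b x y Hb Hx [H| ->]; [left; now apply jump_incr|apply Rle_refl]. }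
  set (x := Rmin x1 x2). set (y := Rmax y1 y2).
  assert (Hx : 0 < x) by now apply Rmin_glb_lt.
  assert (Hy : 0 < y) by (generalize (Rmax_l y1 y2); unfold y; lra).
  assert (Gx1 := mono rhol x x1 Hl Hx (Rmin_l _ _)).
  assert (Gx2 := mono rhor x x2 Hr Hx (Rmin_r _ _)).
  assert (Gy1 := mono rhol y1 y Hl Hy1 (Rmax_l _ _)).
  assert (Gy2 := mono rhor y2 y Hr Hy2 (Rmax_r _ _)).
  destruct (Rlt_dec x y) as [Hxy|Hxy].
  2: { generalize (mono rhol y x Hl Hy ltac:(lra)). lra. }
  set (g := fun t => jump alpha delta rhol t + jump alpha delta rhor t -
                     (ql / rhol - qr / rhor)).
  destruct (IVT_interv g x y) as (z & [Hz _] & Ez); try easy.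
  - intros t [Ht _]. unfold g. apply continuity_pt_minus.
    + apply continuity_pt_plus; apply continuity_pt_jump; lra.
    + now apply continuity_pt_const.
  - unfold g. lra.
  - unfold g. lra.
  - exists z. apply Lax_intersect_jump; try easy. unfold g in Ez. lra.
Qed.

(** Outside [-2, 2], take density 1 on both sides and opposite velocities [u] and
    [- u], where [u] is the limit of [jump 1] at 0 (if [2 < delta]) or at
    infinity (if [delta < -2]).  It is sub-sonic, and the sum of the jumps would
    have to equal its limit [2 * u]. *)
Lemma Lax_no_intersect :
  0 < alpha -> 2 < Rabs delta ->
  exists rhol ql rhor qr,
    subsonic p rhol ql /\ subsonic p rhor qr /\
    forall rho, ~ Lax_intersect p rhol ql rhor qr rho.
Proof.
  intros Ha Hd.
  assert (Hs := sqrt_lt_R0 alpha Ha).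
  assert (Hu : exists u, Rabs u < sqrt alpha /\
             forall x, 0 < x -> jump alpha delta 1 x <> u).
  { destruct (Rle_dec 0 delta) as [H|H].
    - rewrite Rabs_pos_eq in Hd by easy.
      exists (- (sqrt alpha * (2 / delta))). split.
      + assert (0 < 2 / delta) by (apply Rdiv_lt_0_compat; lra).
        assert (2 / delta < 1) by (apply Rlt_div_l; lra).
        rewrite Rabs_Ropp, Rabs_pos_eq; nra.
      + intros x Hx. generalize (jump_1_gt alpha delta x). lra.
    - rewrite Rabs_left in Hd by lra.
      exists (sqrt (alpha / - (delta + 1))). split.
      + rewrite Rabs_pos_eq by apply sqrt_pos.
        assert (0 < alpha / - (delta + 1)) by (apply Rdiv_lt_0_compat; lra).
        apply sqrt_lt_1_alt. split; [lra|]. apply Rlt_div_l; nra.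
      + intros x Hx. generalize (jump_1_lt alpha delta x). lra. }
  destruct Hu as (u & Hu & Hne).
  assert (Hc : sound_speed p 1 = sqrt alpha).
  { rewrite sound_speed_power by lra. unfold power_speed.
    rewrite Rpower_1_l. ring. }
  exists 1, u, 1, (- u). unfold subsonic. rewrite Hc, !Rdiv_1_r, Rabs_Ropp.
  do 2 (split; [lra|]).
  intros rho H. apply Lax_intersect_jump in H; try lra.
  destruct H as [Hrho H]. apply (Hne rho Hrho). rewrite !Rdiv_1_r in H. lra.
Qed.

Lemma admissible_power_iff : admissible p <-> 0 < alpha.
Proof.
  split.
  - intros H. destruct (H 1 Rlt_0_1) as [_ H1].
    rewrite (is_derive_unique _ _ _ (Hp 1 Rlt_0_1)), Rpower_1_l in H1. lra.
  - intros Ha rho Hr. split; [eexists; now apply Hp|].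
    rewrite (is_derive_unique _ _ _ (Hp rho Hr)).
    apply Rmult_lt_0_compat; [easy|apply Rpower_pos].
Qed.

End PowerLaw.

Theorem proposition2 (alpha delta : R) (p : R -> R)
  (Hp : forall rho : R, 0 < rho -> is_derive p rho (alpha * Rpower rho delta)) :
  (let gamma := delta + 1 in
   (gamma <> 0 ->
      exists k : R, forall rho : R, 0 < rho ->
        p rho = alpha / gamma * Rpower rho gamma + k) /\
   (gamma = 0 ->
      exists k : R, forall rho : R, 0 < rho -> p rho = alpha * ln rho + k)) /\
  ((admissible p /\
    forall rhol ql rhor qr : R,
      subsonic p rhol ql -> subsonic p rhor qr ->
      exists! rho : R, Lax_intersect p rhol ql rhor qr rho)
   <-> Rabs delta <= 2 /\ 0 < alpha) /\
  (2 < Rabs delta -> 0 < alpha ->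
   exists rhol ql rhor qr : R,
     subsonic p rhol ql /\ subsonic p rhor qr /\
     forall rho : R, ~ Lax_intersect p rhol ql rhor qr rho).
Proof.
  split; [|split; [split|]].
  - destruct (pressure_power_prim _ _ _ Hp) as [k Hk].
    split; intros Hg; exists k; intros rho Hr; rewrite (Hk rho Hr).
    + rewrite power_prim_neq0 by easy. now field.
    + now rewrite Hg, power_prim_0.
  - intros [Hadm Hex]. apply (admissible_power_iff _ _ _ Hp) in Hadm.
    split; [|easy]. destruct (Rle_dec (Rabs delta) 2) as [H|H]; [easy|].
    destruct (Lax_no_intersect _ _ _ Hp Hadm ltac:(lra))
      as (rhol & ql & rhor & qr & Hl & Hr & Hno).
    destruct (Hex _ _ _ _ Hl Hr) as (rho & Hrho & _).
    now apply Hno in Hrho.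
  - intros [Hd Ha]. split; [now apply (admissible_power_iff _ _ _ Hp)|].
    intros rhol ql rhor qr Hl Hr.
    destruct (Lax_intersect_exists _ _ _ Hp rhol ql rhor qr Ha Hd Hl Hr)
      as [rho Hrho].
    exists rho. split; [easy|]. intros rho' Hrho'.
    destruct Hl as [Hl _], Hr as [Hr _].
    now apply (Lax_intersect_unique _ _ _ Hp rhol ql rhor qr).
  - intros Hd Ha. now apply (Lax_no_intersect _ _ _ Hp).
Qed.
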